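(* Let $W$ be an infinite dimensional vector space over an infinite field $K$ and let $\alpha$, $\mu$, and $\lambda$ be cardinal numbers such that $|K|<\alpha\le\mu<\lambda\leq \dim(W)^+$. Then there exists a star-like set $M\subsetneq W$ containing $0$ such that $A(M)=\alpha$, $m\mathcal{L}(M)=\mu$, and $\mathcal{L}(M)=\lambda$.
   Context: For a cardinal $\kappa$, $\kappa^+$ denotes its cardinal successor, and $|F|$ denotes the cardinality of a set $F$. Let $W$ be a vector space over a field $K$ and $M\subset W$. - $\mathrm{st}(M)=\{w\in W\colon cw\in M \text{ for all } c\in K\setminus\{0\}\}$; $M$ is star-like if $\mathrm{st}(M)=M$. - Lineability number: $\mathcal{L}(M)=\min\{\kappa\colon M\cup\{0\} \text{ contains no vector subspace of dimension } \kappa\}$ ($\kappa$ ranging over cardinals). - Maximal lineability number: $m\mathcal{L}(M)=\min\{\dim(V)\colon V \text{ is a maximal (with respect to inclusion) linear subspace contained in } M\cup\{0\}\}$. - Additivity number: $A(M)=A(M,W)=\min\bigl(\{|F|\colon F\subset W \text{ and } (\forall w\in W)(w+F\not\subset M)\}\cup\{|W|^+\}\bigr)$, where $w+F=\{w+f\colon f\in F\}$. *)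

(* Defs.v *)
From mathcomp Require Import all_boot all_order all_algebra.
From mathcomp Require Import boolp classical_sets functions cardinality.

Set Implicit Arguments.
Unset Strict Implicit.
Unset Printing Implicit Defensive.

Import GRing.Theory.
Local Open Scope ring_scope.
Local Open Scope classical_set_scope.
Local Open Scope card_scope.

(* A cardinal number is represented by any type having that many elements:
   equality of cardinals is equipotence [#=] of the full sets, and their order
   is [#<=] (existence of an injection).  Accordingly, a cardinal-valued
   invariant is given as a relation "k is the value of the invariant", which
   determines k up to equipotence.  Naming the sort once puts all cardinals in
   a single universe. *)
Definition cardinal := Type.

Definition card_lt (T U : Type) (A : set T) (B : set U) : Prop :=
  A #<= B /\ ~ (B #<= A).
Notation "A '#<' B" := (card_lt A B)
  (at level 79, format "A  '#<'  B") : card_scope.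

Definition is_card_min (P : cardinal -> Prop) (k : cardinal) : Prop :=
  P k /\ forall k' : cardinal, P k' -> [set: k] #<= [set: k'].

Definition is_card_succ (k s : cardinal) : Prop :=
  is_card_min (fun s' : cardinal => [set: k] #< [set: s']) s.

Section VectorSpace.
Variables (K : fieldType) (W : lmodType K).
Implicit Types (M V B F : set W).

Definition vsubspace V : Prop := GRing.submod_closed [in V].

Definition lin_indep B : Prop :=
  forall (s : seq W) (c : W -> K), uniq s -> [set` s] `<=` B ->
    \sum_(x <- s) c x *: x = 0 -> forall x, x \in s -> c x = 0.

Definition lin_span B : set W :=
  [set v | exists (s : seq W) (c : W -> K),
    [set` s] `<=` B /\ v = \sum_(x <- s) c x *: x].

Definition is_basis V B : Prop := lin_indep B /\ lin_span B = V.

Definition is_dim V (k : cardinal) : Prop :=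
  exists2 B, is_basis V B & B #= [set: k].

Definition st M : set W := [set w | forall c : K, c != 0 -> M (c *: w)].

Definition star_like M : Prop := st M = M.

Definition is_lineability M (k : cardinal) : Prop :=
  is_card_min (fun k' : cardinal =>
    ~ exists V, [/\ vsubspace V, V `<=` M `|` [set 0] & is_dim V k']) k.

Definition maximal_subspace_in M V : Prop :=
  [/\ vsubspace V, V `<=` M &
      forall V', vsubspace V' -> V' `<=` M -> V `<=` V' -> V' = V].

Definition is_max_lineability M (k : cardinal) : Prop :=
  is_card_min (fun k' : cardinal =>
    exists V, maximal_subspace_in (M `|` [set 0]) V /\ is_dim V k') k.

Definition is_additivity M (k : cardinal) : Prop :=
  is_card_min (fun k' : cardinal =>
    (exists F, F #= [set: k'] /\
       forall w : W, ~ ([set w + f | f in F] `<=` M))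
    \/ is_card_succ W k') k.

End VectorSpace.

(* Main.v *)
Require Import Defs.
From mathcomp Require Import all_boot all_order all_algebra.
From mathcomp Require Import boolp classical_sets functions cardinality.
From mathcomp Require wochoice.

(** Fix a basis [B] of [W].  Choose in [B] a set [A] of cardinality [alpha], an
    element [e] outside [A], and pairwise disjoint sets [P j], avoiding [A] and
    [e], whose cardinalities are [mu + k] with [k] running over the cardinals
    below [lambda].  The set [M] consists of the vectors with a nonzero
    coordinate on [A], together with the union of the spans of the [P j].
    - A set [F] with fewer than [alpha] elements has supports that miss some
      [a] in [A], so [a + F] lies in [M].  The set [span A + {0, e}], which has
      [alpha] elements because [|K| < alpha], has no translate in [M]: for each
      [w] it provides [w + u] and [w + u + e] without coordinates on [A], and
      both cannot lie in the spans of the [P j], which have no [e]-coordinate.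
    - The vectors without coordinates on [A] of a subspace contained in [M] lie
      in the span of a single [P j].  Hence the maximal subspaces contain some
      [span (P j)], the subspaces [span (A `|` P j)] are maximal, and every
      subspace in [M] embeds into one of these. *)

Set Implicit Arguments.
Unset Strict Implicit.
Unset Printing Implicit Defensive.

Import GRing.Theory.
Local Open Scope ring_scope.
Local Open Scope classical_set_scope.
Local Open Scope card_scope.

(** * Comparison of cardinals *)

Definition injects (T U : Type) : Prop := exists f : T -> U, injective f.

Lemma injects_trans {T U V : Type} : injects T U -> injects U V -> injects T V.
Proof. by move=> [f fI] [g gI]; exists (g \o f); exact: inj_comp. Qed.

Lemma injectsxx (T : Type) : injects T T.
Proof. by exists id. Qed.

Lemma card_lesP {T U : Type} {A : set T} {B : set U} : A #<= B <-> injects A B.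
Proof.
split=> [/card_leP[f]|[f fI]].
  by exists f => x y; apply: (@inj _ _ _ f); exact: mem_set.
by apply/card_leP/injfunPex; exists f => //; exact: in2W.
Qed.

Lemma injects_set {T : Type} (A : set T) : injects A T.
Proof. by exists val; exact: val_inj. Qed.

Lemma injects_setT (T : Type) : injects T [set: T].
Proof. by exists (fun x => SigSub (mem_set (I : [set: T] x))) => x y []. Qed.

Lemma card_leTP {T U : Type} : [set: T] #<= [set: U] <-> injects T U.
Proof.
rewrite card_lesP; split=> h.
  exact: injects_trans (injects_setT T) (injects_trans h (injects_set _)).
exact: injects_trans (injects_set _) (injects_trans h (injects_setT _)).
Qed.

Lemma card_leTsP {T U : Type} {A : set T} : A #<= [set: U] <-> injects A U.
Proof.
rewrite card_lesP; split=> h; first exact: injects_trans h (injects_set _).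
exact: injects_trans h (injects_setT _).
Qed.

Lemma card_lesTP {T U : Type} {B : set U} : [set: T] #<= B <-> injects T B.
Proof.
rewrite card_lesP; split=> h; first exact: injects_trans (injects_setT _) h.
exact: injects_trans (injects_set _) h.
Qed.

Lemma infinite_injects {T : Type} : infinite_set [set: T] <-> injects nat T.
Proof. by rewrite infiniteP card_leTP. Qed.

Lemma well_ordering (T : Type) : exists lt : T -> T -> Prop,
  [/\ well_founded lt,
      (forall A : set T, A !=set0 -> exists2 m, A m & forall y, A y -> ~ lt y m)
    & (forall x y, x <> y -> lt x y \/ lt y x)].
Proof.
elim/Peq : T => T; have [R woR] := @wochoice.well_ordering_principle T.
have ch : wochoice.wo_chain R predT by move=> A _; exact: woR.
have tot : {in predT &, total R} := wochoice.wo_chainW ch.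
have anti := wochoice.wo_chain_antisymmetric ch.
pose lt x y := R x y /\ x <> y.
have min (A : set T) : A !=set0 -> exists2 m, A m & forall y, A y -> ~ lt y m.
  move=> [x Ax]; have [|m [[]]] := woR [pred x | `[<A x>]].
    by exists x; rewrite inE.
  rewrite inE => Am mmin _; exists m => // y Ay [Rym]; apply.
  by apply: anti => //; rewrite Rym mmin// inE.
have wf : well_founded lt.
  move=> x; apply: contrapT => nAx.
  have [m nAm mmin] := min [set x | ~ Acc lt x] (ex_intro _ x nAx).
  by apply: nAm; constructor => y ym; apply: contrapT => nAy; exact: mmin ym.
exists lt; split; [exact: wf|exact: min|move=> x y xy].
by have /orP[] := tot x y isT isT; [left|right]; split=> // /esym.
Qed.

(* Transfinite recursion sends each [x] to the least element of [U] not yet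
   used. *)
Lemma injects_segment {T U : Type} (lt : U -> U -> Prop) :
  (forall A : set U, A !=set0 -> exists2 m, A m & forall y, A y -> ~ lt y m) ->
  injects U T \/ exists S : set U,
    [set: T] #= S /\ forall x y, S x -> lt y x -> S y.
Proof.
move=> minU; have [ltT [wfT _ totT]] := well_ordering T.
pose avail x (rec : forall y, ltT y x -> option U) (u : U) :=
  forall y h, rec y h <> Some u.
pose least x rec u := avail x rec u /\ forall v, avail x rec v -> ~ lt v u.
(* The value [None] marks a stage at which [U] is exhausted; the earlier values then cover [U], and
   choosing preimages injects [U] into [T]. *)
pose step x rec := if pselect (exists u, least x rec u) is left h
  then Some (projT1 (cid h)) else None.
pose f := Fix wfT (fun=> option U) step.
have fE x : f x = step x (fun y _ => f y).
  apply: Fix_eq => {}x g h gh; congr step.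
  by apply: functional_extensionality_dep => y;
     apply: functional_extensionality_dep => z.
have fP x u : f x = Some u -> least x (fun y _ => f y) u.
  rewrite fE /step; case: pselect => // h [<-]; exact: projT2 (cid h).
have fNone x : f x = None -> forall u, exists2 y, ltT y x & f y = Some u.
  rewrite fE /step; case: pselect => // h _ u; apply: contrapT => nu.
  have [|m ? ?] := minU (avail x (fun y _ => f y)); last by apply: h; exists m.
  by exists u => y yx /= fy; apply: nu; exists y.
have [[x /fNone g]|noN] := pselect (exists x, f x = None).
  left; have /choice[h hP] : forall u, exists y, f y = Some u.
    by move=> u; have [y] := g u; exists y.
  by exists h => u v uv; have := hP u; rewrite uv hP => -[].
right; have /choice[g gP] : forall x, exists u, f x = Some u.
  by move=> x; case E : (f x) => [u|]; [exists u|case: noN; exists x].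
have gI : injective g.
  move=> x y xy; apply: contrapT => /totT[xy'|yx'].
    by have [/(_ x xy')] := fP _ _ (gP y); rewrite gP xy.
  by have [/(_ y yx')] := fP _ _ (gP x); rewrite gP xy.
exists (range g); split; first by rewrite card_eq_sym; apply: inj_card_eq; exact: in2W.
move=> _ v [x _ <-] vx; have [_ gmin] := fP _ _ (gP x).
apply: contrapT => nv; apply: (gmin v) => // y yx; rewrite gP => -[yv].
by apply: nv; exists y.
Qed.

Lemma injects_total (T U : Type) : injects T U \/ injects U T.
Proof.
have [lt [_ minU _]] := well_ordering U.
have [h|[S [TS _]]] := @injects_segment T U lt minU; [by right|left].
by apply/card_leTP/(card_le_trans _ (card_leT S)); have /card_eqPle[] := TS.
Qed.

(** Serves to index all cardinals up to that of [U] by [option U]. By [injects_segment] such a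
    cardinal is that of [U], coded by [None], or of a down-closed subset; a proper one consists of
    the elements below the least element outside it. *)
Lemma segments_realize_cardinals (U : Type) : exists seg : option U -> set U,
  forall T : Type, injects T U -> exists o, [set: T] #= seg o.
Proof.
have [lt [_ minU totU]] := well_ordering U.
exists (fun o => if o is Some d then [set y | lt y d] else setT) => T TU.
have [UT|[S [TS Sdown]]] := injects_segment (T := T) minU.
  by exists None; apply/card_eqPle; split; exact/card_leTP.
have [ST|nST] := eqVneq S setT; first by exists None; rewrite -ST.
have [|d nSd dmin] := minU (~` S).
  by apply/set0P; apply: contra_neq nST => S0; rewrite -[S]setCK S0 setC0.
exists (Some d); rewrite (_ : [set y | _] = S)//.
apply/seteqP; split=> [y /= yd|y Sy /=]; first by apply: contrapT => /dmin /(_ yd).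
have [|//|dy] := totU y d; first by move=> yd; rewrite yd in Sy.
by case: nSd; exact: Sdown Sy dy.
Qed.

(** * Infinite cardinal arithmetic *)

Lemma injects_fun {T U : Type} {A : set T} {B : set U} (u0 : U) :
  injects A B -> exists f : T -> U, (forall x, A x -> B (f x)) /\
    (forall x y, A x -> A y -> f x = f y -> x = y).
Proof.
move=> [g gI].
have /choice[f fP] : forall x, exists u, forall h : A x, u = val (g (SigSub (mem_set h))).
  move=> x; have [h|nh] := pselect (A x); last by exists u0.
  by exists (val (g (SigSub (mem_set h)))) => h'; rewrite (Prop_irrelevance h h').
exists f; split=> [x h|x y hx hy].
  by rewrite (fP x h); apply: set_mem; exact: valP.
by rewrite (fP x hx) (fP y hy) => /val_inj/gI[].
Qed.

(* Zorn's lemma applied to the graphs of injections [S * S -> S] that extend a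
   fixed one with [S] countably infinite.  A maximal [S] cannot inject into its
   complement, so its complement injects into [S], and then so does [X]. *)
Lemma injects_square {X : Type} : injects nat X -> injects (X * X) X.
Proof.
move=> [nu nuI].
have [pr prI] : injects (nat * nat) nat.
  by apply/card_leTP; have /card_eqPle[] := card_nat2.
(* The set [S] with [G] defined on [S * S] is read off the diagonal. The relation [G] need not be
   single-valued: injectivity is what matters, and values are chosen once [G] is maximal. *)
pose dom (G : set (X * X * X)) x := exists z, G (x, x, z).
pose sq G := [/\ forall x y z, G (x, y, z) -> [/\ dom G x, dom G y & dom G z],
  forall x y, dom G x -> dom G y -> exists z, G (x, y, z) &
  forall x y x' y' z, G (x, y, z) -> G (x', y', z) -> x = x' /\ y = y'].
pose G0 : set (X * X * X) :=
  [set t | exists i j, t = (nu i, nu j, nu (pr (i, j)))].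
have dom0 i : dom G0 (nu i) by exists (nu (pr (i, i))), i, i.
have sq0 : sq G0.
  split=> [x y z [i [j [-> -> ->]]]|x y [_ [i [_ [-> _ _]]]] [_ [j [_ [-> _ _]]]]|].
  - by split; exact: dom0.
  - by exists (nu (pr (i, j))), i, j.
  - by move=> x y x' y' z [i [j [-> -> ->]]] [i' [j' [-> -> /nuI/prI[-> ->]]]].
(* Adding [G0] inside the property, instead of asking that [G] contain it, lets the empty chain
   pass. *)
have [F FP Ftot|G [sqG Gmax]] := @Zorn_bigcup _ (fun G => sq (G `|` G0)).
  set H := _ `|` G0.
  (* Two triples of the union lie in a common [Y] satisfying [sq], so each condition of [sq] passes
     to the union. *)
  have common t t' : H t -> H t' -> exists Y, [/\ sq Y, Y `<=` H, Y t & Y t'].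
    have sub Y : F Y -> Y `|` G0 `<=` H.
      by move=> FY s [Ys|?]; [left; exists Y|right].
    move=> [[Y FY Yt]|G0t] [[Y' FY' Yt']|G0t'].
    - have [YY'|YY'] := Ftot _ _ FY FY'.
      + exists (Y' `|` G0); split; [exact: FP|exact: sub|by left; exact: YY'|by left].
      + exists (Y `|` G0); split; [exact: FP|exact: sub|by left|by left; exact: YY'].
    - exists (Y `|` G0); split; [exact: FP|exact: sub|by left|by right].
    - exists (Y' `|` G0); split; [exact: FP|exact: sub|by right|by left].
    - by exists G0; split=> // s; right.
  have domS Y x : Y `<=` H -> dom Y x -> dom H x.
    by move=> YH [z /YH]; exists z.
  split=> [x y z h|x y [z h] [z' h']|x y x' y' z h h'].
  - have [Y [[sqY _ _] YH /sqY[? ? ?] _]] := common _ _ h h.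
    by split; apply: domS YH _.
  - have [Y [[_ sqY _] YH Yt Yt']] := common _ _ h h'.
    have [||w Yw] := sqY x y; [by exists z|by exists z'|].
    by exists w; exact: YH.
  - by have [Y [[_ _ sqY] YH Yt Yt']] := common _ _ h h'; exact: sqY Yt Yt'.
move: sqG Gmax; set H := _ `|` G0 => sqH Gmax.
have Hmax H' : sq H' -> H `<=` H' -> H' `<=` H.
  move=> sqH' HH'; apply: contrapT => nH'H.
  have GH : G `<=` H by move=> ? ?; left.
  apply: (Gmax H').
    by split; [exact: subset_trans HH'|move=> H'G; apply: nH'H; exact: subset_trans GH].
  by rewrite (_ : H' `|` G0 = H')//; apply/setUidPl => t ?; apply: HH'; right.
have [HS Hex HI] := sqH; set S : set X := dom H in HS Hex.
have nuS i : S (nu i) by have [z ?] := dom0 i; exists z; right.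
have /choice[p' p'P] : forall xy, exists z, S xy.1 -> S xy.2 -> H (xy.1, xy.2, z).
  move=> [x y]; have [[Sx Sy]|nS] := pselect (S x /\ S y).
    by have [z] := Hex x y Sx Sy; exists z.
  by exists x => /= Sx Sy; case: nS.
pose p x y := p' (x, y).
have pH x y : S x -> S y -> H (x, y, p x y) by exact: (p'P (x, y)).
have pS x y : S x -> S y -> S (p x y) by move=> Sx Sy; have [] := HS _ _ _ (pH x y Sx Sy).
have pI x y x' y' : S x -> S y -> S x' -> S y' -> p x y = p x' y' -> x = x' /\ y = y'.
  move=> Sx Sy Sx' Sy' e; apply: (HI _ _ _ _ (p x y)); first exact: pH.
  by rewrite e; exact: pH.
have [|] := injects_total (~` S) S.
  move=> /(injects_fun (nu 0%N))[q [qS qI]].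
  (* Pairing with [nu 0%N] or [nu 1%N] separates [S] from its complement, so [f] injects [X] into
     [S], where [p] codes pairs. *)
  pose f x := if pselect (S x) then p x (nu 0%N) else p (q x) (nu 1%N).
  have fS x : S (f x) by rewrite /f; case: pselect => h; apply: pS => //; exact: qS.
  have fI : injective f.
    move=> x y; rewrite /f; case: pselect => hx; case: pselect => hy /pI[]//.
    - by apply: qS.
    - by move=> _ /nuI.
    - by apply: qS.
    - by move=> _ /nuI.
    - by apply: qS.
    - by apply: qS.
    - by move=> /qI ->.
  exists (fun xy => p (f xy.1) (f xy.2)) => -[x y] [x' y'] /= /pI[]// /fI -> /fI ->.
  by [].
move=> /(injects_fun (nu 0%N))[q [qS qI]]; exfalso.
(* The square is extended to the union of [S] and its image under [q]. New pairs get codes in that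
   image, away from the old values; the part [p (nu i) (nu j)] of a code records which coordinates
   are new. *)
pose lr (i : bool) a := if i then q a else a.
pose code (i j : bool) a b := q (p (p a b) (p (nu i) (nu j))).
pose H' := H `|` [set t | exists i j a b,
  [/\ i || j, S a, S b & t = (lr i a, lr j b, code i j a b)]].
have HH' : H `<=` H' by move=> ? ?; left.
have domS a : S a -> dom H' a by move=> [z /HH']; exists z.
have domq a : S a -> dom H' (q a).
  by move=> Sa; exists (code true true a a); right; exists true, true, a, a.
have domlr i a : S a -> dom H' (lr i a) by case: i; [exact: domq|exact: domS].
have lrdom x : dom H' x -> exists i a, S a /\ x = lr i a.
  move=> [z [/HS[? _ _]|[i [_ [a [_ [_ Sa _ [-> _ _]]]]]]]]; first by exists false, x.
  by exists i, a.
have codeS (i j : bool) a b : S a -> S b -> S (p (p a b) (p (nu i) (nu j))).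
  by move=> Sa Sb; do 2!apply: (pS).
have sqH' : sq H'.
  split.
  - move=> x y z [/HS[? ? ?]|[i [j [a [b [_ Sa Sb [-> -> ->]]]]]]].
      by split; exact: domS.
    by split; [exact: domlr|exact: domlr|apply/domq/codeS].
  - move=> x y /lrdom[i [a [Sa ->]]] /lrdom[j [b [Sb ->]]].
    have [ij|/norP[/negbTE-> /negbTE->]] := boolP (i || j).
      by exists (code i j a b); right; exists i, j, a, b.
    by exists (p a b); left; exact: pH.
  - move=> x y x' y' z [h|[i [j [a [b [_ Sa Sb [-> -> ->]]]]]]] [h'|].
    + exact: HI h h'.
    + move=> [i [j [a [b [_ Sa Sb [_ _ zE]]]]]]; have [_ _] := HS _ _ _ h.
      by rewrite zE; move=> Sz; case: (qS _ (codeS i j a b Sa Sb) Sz).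
    + by have [_ _] := HS _ _ _ h'; move=> Sz; case: (qS _ (codeS i j a b Sa Sb) Sz).
    + move=> [i' [j' [a' [b' [_ Sa' Sb' [-> -> /qI e]]]]]].
      have /pI[||||] := e (codeS _ _ _ _ Sa Sb) (codeS _ _ _ _ Sa' Sb').
      1-4: by apply: pS.
      move=> /pI[]// -> -> /pI[]// /nuI ii' /nuI jj'.
      by move: ii' jj' => {e}; case: i; case: i' => //; case: j; case: j'.
have [z /(Hmax _ sqH' HH')/HS[Sq _ _]] := domq _ (nuS 0%N).
exact: qS (nuS 0%N) Sq.
Qed.

Section InfiniteArithmetic.
Variable X : Type.
Hypothesis infX : injects nat X.

Lemma injects_prod {A B : Type} : injects A X -> injects B X -> injects (A * B) X.
Proof.
move=> [f fI] [g gI]; apply: injects_trans (injects_square infX).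
by exists (fun ab => (f ab.1, g ab.2)) => -[a b] [a' b'] [/fI-> /gI->].
Qed.

Lemma injects_sum {A B : Type} : injects A X -> injects B X -> injects (A + B) X.
Proof.
move=> [f fI] [g gI]; have [nu nuI] := infX.
apply: injects_trans (injects_square infX).
exists (fun s => match s with inl a => (nu 0%N, f a) | inr b => (nu 1%N, g b) end).
by move=> [a|b] [a'|b'] []; [move=> /fI->|move=> /nuI|move=> /nuI|move=> /gI->].
Qed.

Lemma injects_setU {T : Type} {A B : set T} :
  injects A X -> injects B X -> injects (A `|` B) X.
Proof.
move=> AX BX; apply: injects_trans (injects_sum AX BX).
have /choice[f fP] : forall x : (A `|` B : set T), exists s : A + B,
    val x = match s with inl a => val a | inr b => val b end.
  move=> x; have [Ax|Bx] := set_mem (valP x).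
    by exists (inl (SigSub (mem_set Ax))).
  by exists (inr (SigSub (mem_set Bx))).
by exists f => x y fxy; apply: val_inj; rewrite !fP fxy.
Qed.

Lemma injects_option {A : Type} : injects A X -> injects (option A) X.
Proof.
move=> AX; apply: injects_trans (injects_sum infX AX).
by exists (fun o => if o is Some a then inr a else inl 0%N) => -[a|] [a'|]// [->].
Qed.

Lemma injects_seq {A : Type} : injects A X -> injects (seq A) X.
Proof.
move=> [f fI]; have [nu nuI] := infX; have [p pI] := injects_square infX.
pose enc := foldr (fun a r => p (f a, r)) (nu 0%N).
apply: injects_trans (injects_prod infX (injectsxx X)).
(* The length is recorded too, since the code [nu 0%N] of the empty sequence may also be the code of
   a pair. *)
exists (fun s => (size s, enc s)).
elim=> [|a s IH] [|b t]//= [st /pI[/fI-> est]]; congr cons.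
by apply: IH; rewrite st est.
Qed.

(** A point of the union is coded by one index whose set contains it, together with its number under
    an injection of that set into [nat]. *)
Lemma injects_bigcup_finite {T U : Type} {A : set T} {G : T -> set U} :
  injects A X -> (forall x, A x -> finite_set (G x)) ->
  injects (\bigcup_(x in A) G x) X.
Proof.
move=> AX finG; apply: injects_trans (injects_prod AX infX).
have /choice[f fP] : forall u : (\bigcup_(x in A) G x : set U),
    exists x : A, G (val x) (val u).
  by move=> u; have [x Ax Gx] := set_mem (valP u); exists (SigSub (mem_set Ax)).
have /choice[g gP] : forall x : A, exists g : U -> nat, {in G (val x) &, injective g}.
  move=> x; have /finite_set_countable/countable_injP[g gI] := finG _ (set_mem (valP x)).
  by exists g.
exists (fun u => (f u, g (f u) (val u))) => u v [fuv].
rewrite fuv => /gP h; apply/val_inj/h; rewrite inE//.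
by rewrite -fuv.
Qed.

End InfiniteArithmetic.

(** * Spans and coordinates *)

Section Subspace.
Context {K : fieldType} {W : lmodType K}.
Implicit Types (V S B : set W).

Lemma vsubspaceP {V} : vsubspace V <->
  V 0 /\ forall (a : K) u v, V u -> V v -> V (a *: u + v).
Proof.
split=> [[V0 VD]|[V0 VD]].
  split=> [|a u v Vu Vv]; first exact: set_mem.
  by apply: set_mem; apply: VD; exact: mem_set.
split=> [|a u v /set_mem Vu /set_mem Vv]; first exact: mem_set.
by apply: mem_set; exact: VD.
Qed.

Lemma vsubspaceD {V} : vsubspace V -> forall u v, V u -> V v -> V (u + v).
Proof. by move=> /vsubspaceP[_ VD] u v Vu Vv; rewrite -[u]scale1r; exact: VD. Qed.

Lemma vsubspaceZ {V} : vsubspace V -> forall (a : K) u, V u -> V (a *: u).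
Proof. by move=> /vsubspaceP[V0 VD] a u Vu; rewrite -[_ *: _]addr0; exact: VD. Qed.

Lemma vsubspaceB {V} : vsubspace V -> forall u v, V u -> V v -> V (u - v).
Proof.
move=> hV u v Vu Vv; rewrite -scaleN1r; apply: vsubspaceD => //.
exact: vsubspaceZ.
Qed.

Lemma lin_indepS {S B} : S `<=` B -> lin_indep B -> lin_indep S.
Proof. by move=> SB hB s c us /subset_trans/(_ SB); exact: hB. Qed.

Lemma sub_lin_span {S} : S `<=` lin_span S.
Proof.
move=> x Sx; exists [:: x], (fun=> 1); split; last by rewrite big_seq1 scale1r.
by move=> y; rewrite /= inE => /eqP->.
Qed.

(** The span is an image of the finite sequences of pairs of a coefficient and an element of [S]. *)
Lemma injects_lin_span {S} {X : Type} : injects nat X ->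
  injects K X -> injects S X -> injects (lin_span S) X.
Proof.
move=> infX KX SX.
have /injects_trans : injects (lin_span S) (seq (K * S)).
  apply/card_leTsP; pose F (l : seq (K * S)) := \sum_(p <- l) p.1 *: val p.2.
  apply: (@card_le_trans _ _ _ (range F)); last exact: card_image_le.
  apply: subset_card_le => _ [s [c [sS ->]]].
  exists (pmap (fun x => omap (fun y => (c x, y)) (insub x)) s) => //.
  rewrite /F; elim: s sS => [|x s IH] sS; first by rewrite !big_nil.
  have Sx : x \in S by apply/mem_set/sS; rewrite /= mem_head.
  rewrite /= insubT /= !big_cons /= IH// => y /= ys.
  by apply: sS; rewrite /= in_cons ys orbT.
by apply; apply: injects_seq => //; exact: injects_prod.
Qed.

End Subspace.

Section Coordinates.
Context {K : fieldType} {W : lmodType K}.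
Implicit Types (S B : set W) (g : W -> K) (cf : W -> W -> K).

(** The coefficients form a total function vanishing off [s], so that uniqueness becomes an equality
    of functions. *)
Definition decomposition B (w : W) g := exists s : seq W,
  [/\ uniq s, [set` s] `<=` B, (forall x, x \notin s -> g x = 0)
    & w = \sum_(x <- s) g x *: x].

(** For [x] in [B], [cf w x] is the [x]-coordinate of [w]; for [x] outside [B] it is 0. *)
Definition coordinates B cf :=
  [/\ (forall a u v x, cf (a *: u + v) x = a * cf u x + cf v x),
      (forall w, decomposition B w (cf w))
    & (forall x y, B x -> cf x y = (x == y)%:R)].

Lemma big_widen_support g (s t : seq W) : uniq s -> uniq t -> {subset s <= t} ->
  (forall x, x \notin s -> g x = 0) ->
  \sum_(x <- s) g x *: x = \sum_(x <- t) g x *: x.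
Proof.
move=> us ut st g0; rewrite [RHS](bigID (mem s)) /= [X in _ + X]big1 ?addr0.
  rewrite -[RHS]big_filter; apply: perm_big; apply: uniq_perm => //; first exact: filter_uniq.
  by move=> x; rewrite mem_filter andb_idr//; exact: st.
by move=> x /g0->; rewrite scale0r.
Qed.

Lemma decompositionD B (a : K) u v g h :
  decomposition B u g -> decomposition B v h ->
  decomposition B (a *: u + v) (fun x => a * g x + h x).
Proof.
move=> [s [us sB gs ->]] [t [ut tB ht ->]].
exists (undup (s ++ t)); split; first exact: undup_uniq.
- by move=> x /=; rewrite mem_undup mem_cat => /orP[/sB|/tB].
- move=> x; rewrite mem_undup mem_cat negb_or => /andP[/gs-> /ht->].
  by rewrite mulr0 addr0.
rewrite (@big_widen_support g s (undup (s ++ t)))// ?undup_uniq//; last first.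
  by move=> x xs; rewrite mem_undup mem_cat xs.
rewrite (@big_widen_support h t (undup (s ++ t)))// ?undup_uniq//; last first.
  by move=> x xs; rewrite mem_undup mem_cat xs orbT.
rewrite scaler_sumr -big_split /=; apply: eq_bigr => x _.
by rewrite scalerDl scalerA.
Qed.

Lemma decomposition_basis B x : B x -> decomposition B x (fun y => (x == y)%:R).
Proof.
move=> Bx; exists [:: x]; split=> //.
- by move=> y; rewrite /= inE => /eqP->.
- by move=> y; rewrite inE eq_sym => /negbTE->.
- by rewrite big_seq1 eqxx scale1r.
Qed.

Lemma decomposition_uniq B w g h : lin_indep B ->
  decomposition B w g -> decomposition B w h -> g = h.
Proof.
(* The difference of the two decompositions is a decomposition of 0. *)
move=> iB dg dh; have [s [us sB gs /esym]] := decompositionD (-1) dg dh.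
rewrite scaleN1r addNr => /(iB _ _ us sB) s0; apply/funext => x.
apply/esym/eqP; rewrite -subr_eq0 addrC -mulN1r; apply/eqP.
by have [/s0//|/gs] := boolP (x \in s).
Qed.

Lemma basis_coordinates B : is_basis [set: W] B -> exists cf, coordinates B cf.
Proof.
move=> [iB spanB].
have /choice[cf cfP] : forall w, exists g, decomposition B w g.
  move=> w; have [s [c [sB ->]]] : lin_span B w by rewrite spanB.
  (* The sequence [s] may have repetitions, so coefficients are accumulated term by term. *)
  elim: s sB => [|x s IH] sB.
    by exists (fun=> 0); exists [::]; split; rewrite ?big_nil.
  have [|g dg] := IH; first by move=> y ys; apply: sB; rewrite /= in_cons ys orbT.
  exists (fun y => c x * (x == y)%:R + g y); rewrite big_cons.
  apply: decompositionD => //; apply: decomposition_basis.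
  by apply: sB; rewrite /= mem_head.
exists cf; split=> [a u v x||x y Bx]; last 1 first.
- by rewrite (decomposition_uniq iB (cfP x) (decomposition_basis Bx)).
- by rewrite (decomposition_uniq iB (cfP _) (decompositionD a (cfP u) (cfP v))).
- exact: cfP.
Qed.

Section Theory.
Variables (B : set W) (cf : W -> W -> K).
Hypothesis cfP : coordinates B cf.

Lemma coordD u v x : cf (u + v) x = cf u x + cf v x.
Proof. by have [l _ _] := cfP; rewrite -[u]scale1r l mul1r scale1r. Qed.

Lemma coord0 x : cf 0 x = 0.
Proof. by apply: (addrI (cf 0 x)); rewrite -coordD !addr0. Qed.

Lemma coordZ a u x : cf (a *: u) x = a * cf u x.
Proof. by have [l _ _] := cfP; rewrite -[_ *: _]addr0 l coord0 addr0. Qed.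

Lemma coordB u v x : cf (u - v) x = cf u x - cf v x.
Proof. by rewrite coordD -scaleN1r coordZ mulN1r. Qed.

Lemma coord_basis x y : B x -> cf x y = (x == y)%:R.
Proof. by have [_ _] := cfP; apply. Qed.

Lemma coord_inj u v : (forall x, cf u x = cf v x) -> u = v.
Proof.
move=> uv; apply/eqP; rewrite -subr_eq0; apply/eqP.
have [_ /(_ (u - v))[s [_ _ _ ->]] _] := cfP.
by rewrite big1// => x _; rewrite coordB uv subrr scale0r.
Qed.

Lemma coord_finite w : finite_set [set x | cf w x != 0].
Proof.
have [_ /(_ w)[s [_ _ s0 _]] _] := cfP.
apply: sub_finite_set (finite_seq s) => x /=.
by apply: contra_neqT => /s0.
Qed.

Lemma lin_spanE S : S `<=` B ->
  lin_span S = [set w | forall x, cf w x != 0 -> S x].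
Proof.
move=> SB; apply/seteqP; split=> [w [s [c [sS ->]]] x|w wS].
  apply: contraPP => nSx; rewrite (_ : cf _ x = 0) ?eqxx//.
  elim: s sS => [|y s IH] sS; first by rewrite big_nil coord0.
  rewrite big_cons coordD coordZ IH ?addr0; last first.
    by move=> z zs; apply: sS; rewrite /= in_cons zs orbT.
  have Sy : S y by apply: sS; rewrite /= mem_head.
  rewrite coord_basis; last exact: SB.
  by case: eqP => [yx|]; [rewrite yx in Sy|rewrite mulr0].
have [_ /(_ w)[s [_ _ _ wE]] _] := cfP.
exists [seq x <- s | cf w x != 0], (cf w); split.
  by move=> x; rewrite /= mem_filter => /andP[/wS].
rewrite {1}wE big_filter [LHS](bigID (fun x => cf w x != 0)) /= [X in _ + X]big1 ?addr0//.
by move=> x /negPn/eqP->; rewrite scale0r.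
Qed.

Lemma lin_span_vsubspace S : S `<=` B -> vsubspace (lin_span S).
Proof.
move=> SB; rewrite (lin_spanE SB); apply/vsubspaceP; split=> [x|a u v uS vS x].
  by rewrite coord0 eqxx.
have [/uS//|/negPn/eqP u0] := boolP (cf u x != 0).
by rewrite coordD coordZ u0 mulr0 add0r; exact: vS.
Qed.

(** The projection keeps those terms of the decomposition of [w] that are indexed by [S]. *)
Lemma coord_projection S w : S `<=` B -> exists p, lin_span S p /\
  forall x, cf p x = if x \in S then cf w x else 0.
Proof.
move=> SB; have [_ /(_ w)[s [us sB s0 wE]] _] := cfP.
have linp (t : seq W) (c : W -> K) x : [set` t] `<=` B -> uniq t ->
    cf (\sum_(y <- t) c y *: y) x = if x \in t then c x else 0.
  elim: t => [|y t IH] tB; first by rewrite big_nil coord0.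
  rewrite big_cons coordD coordZ /= => /andP[yt ut]; rewrite IH//; last first.
    by move=> z zt; apply: tB; rewrite /= in_cons zt orbT.
  rewrite coord_basis; last by apply: tB; rewrite /= mem_head.
  rewrite in_cons [x == y]eq_sym; case: eqP => [<-|]; last by rewrite mulr0 add0r.
  by rewrite (negbTE yt) mulr1 addr0.
pose t := [seq x <- s | x \in S].
exists (\sum_(x <- t) cf w x *: x); split.
  exists t, (cf w); split=> // x.
  by rewrite /= mem_filter => /andP[/set_mem].
move=> x; rewrite linp ?filter_uniq//; last first.
  by move=> y; rewrite /= mem_filter => /andP[_ /sB].
rewrite mem_filter; case: (x \in S) => //=.
by case: ifP => // /negbT/s0.
Qed.

Lemma lin_span_is_dim S (k : cardinal) : lin_indep B -> S `<=` B ->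
  S #= [set: k] -> is_dim (lin_span S) k.
Proof. by move=> iB SB Sk; exists S => //; split=> //; exact: lin_indepS iB. Qed.

(* Every element of [P] occurs in the support of some element of [B']. *)
Lemma card_le_generating (P B' : set W) : infinite_set P ->
  P `<=` B -> P `<=` lin_span B' -> P #<= B'.
Proof.
move=> infP PB PB'; pose supp b := [set x | cf b x != 0].
have Psub : P `<=` \bigcup_(b in B') supp b.
  move=> p Pp; apply: contrapT => np.
  suff : cf p p = 0 by rewrite coord_basis ?eqxx; [move/eqP; rewrite oner_eq0|exact: PB].
  have [s [c [sB' {1}->]]] := PB' _ Pp.
  elim: s sB' => [|b s IH] sB'; first by rewrite big_nil coord0.
  rewrite big_cons coordD coordZ IH ?addr0; last first.
    by move=> z zs; apply: sB'; rewrite /= in_cons zs orbT.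
  have [->|bp] := eqVneq (cf b p) 0; first by rewrite mulr0.
  by case: np; exists b => //; apply: sB'; rewrite /= mem_head.
(* Supports are finite, so a finite [B'] would reach only finitely many elements of [P]; for
   infinite [B'] the union of the supports is no larger than [B']. *)
have infB' : infinite_set B'.
  move=> finB'; apply: infP; apply: sub_finite_set Psub _.
  by apply: bigcup_finite => // b _; exact: coord_finite.
apply/card_lesP; apply: injects_trans (card_lesP.1 (subset_card_le Psub)) _.
apply: injects_bigcup_finite; first exact/card_lesTP/infiniteP.
  exact: injectsxx.
by move=> b _; exact: coord_finite.
Qed.

End Theory.
End Coordinates.

(** * The star-like set *)

Section Construction.
Context {K : fieldType} {W : lmodType K} {B : set W} {cf : W -> W -> K}.
Hypothesis cfP : coordinates B cf.
Context {J : Type} {A : set W} {e : W} {P : J -> set W} (i0 : J).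
Hypotheses (AB : A `<=` B) (Be : B e) (nAe : ~ A e).
Hypotheses (PB : forall i, P i `<=` B) (PA : forall i x, P i x -> ~ A x).
Hypotheses (nPe : forall i, ~ P i e).
Hypotheses (Pdisj : forall i j x, P i x -> P j x -> i = j).
Hypotheses (Pnonempty : forall i, P i !=set0).

Definition star_set : set W :=
  [set w | (exists2 a, A a & cf w a != 0) \/ exists i, lin_span (P i) w].

Let vanish w := forall a, A a -> cf w a = 0.

Let APB i : A `|` P i `<=` B.
Proof. by move=> x [/AB|/PB]. Qed.

Let star_set_vanish w : vanish w -> star_set w -> exists i, lin_span (P i) w.
Proof. by move=> w0 [[a Aa]|//]; rewrite w0// eqxx. Qed.

Let lin_span_vanish i w : lin_span (P i) w -> vanish w.
Proof.
rewrite (lin_spanE cfP (PB (i := i))) => wP a Aa; apply/eqP.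
by apply: contraT => /wP/PA.
Qed.

Lemma star_set_proper : star_set `<` [set: W].
Proof.
split=> // /(_ e I)[[a Aa]|[i]].
  by rewrite (coord_basis cfP)//; have [ea|] := eqVneq e a; [move: Aa; rewrite -ea|rewrite eqxx].
rewrite (lin_spanE cfP (PB (i := i))) => /(_ e).
by rewrite (coord_basis cfP)// eqxx oner_eq0 => /(_ isT)/nPe.
Qed.

Lemma star_set0 : star_set 0.
Proof. by right; exists i0; have /vsubspaceP[] := lin_span_vsubspace cfP (PB (i := i0)). Qed.

Lemma star_setU0 : star_set `|` [set 0] = star_set.
Proof. by apply/setUidPl => _ ->; exact: star_set0. Qed.

Lemma star_set_star_like : star_like star_set.
Proof.
apply/seteqP; split=> w; first by move=> /(_ 1 (oner_neq0 K)); rewrite scale1r.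
move=> [[a Aa wa]|[i wi]] c c0; [left|right].
  by exists a => //; rewrite (coordZ cfP) mulf_neq0.
by exists i; apply: vsubspaceZ wi; exact: (lin_span_vsubspace cfP (PB (i := i))).
Qed.

(** If [a] in [A] lies in the support of no [f] in [F], every [a + f] has coordinate 1 at [a]. *)
Lemma star_set_translate (F : set W) :
  ~ (A `<=` \bigcup_(f in F) [set x | cf f x != 0]) ->
  exists w, [set w + f | f in F] `<=` star_set.
Proof.
move=> nA; have [a Aa na] : exists2 a, A a & forall f, F f -> cf f a = 0.
  apply: contrapT => h; apply: nA => a Aa; apply: contrapT => na; apply: h.
  exists a => // f Ff; apply/eqP; apply: contraT => fa.
  by exfalso; apply: na; exists f.
exists a => _ [f Ff <-]; left; exists a => //.
by rewrite (coordD cfP) (na f Ff) addr0 (coord_basis cfP) ?eqxx ?oner_eq0//; exact: AB.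
Qed.

Definition untranslatable : set W :=
  lin_span A `|` [set u + e | u in lin_span A].

Lemma star_set_untranslatable w :
  ~ ([set w + f | f in untranslatable] `<=` star_set).
Proof.
(* Removing the projection [p] of [w] onto the span of [A] leaves [w - p] and [w - p + e] without
   coordinates on [A]. *)
move=> h; have [p [Ap pE]] := coord_projection cfP w AB.
have Anp : lin_span A (- p).
  by rewrite -scaleN1r; apply: vsubspaceZ Ap; exact: (lin_span_vsubspace cfP AB).
have van : vanish (w - p).
  by move=> a Aa; rewrite (coordB cfP) pE mem_set// subrr.
have vane : vanish (w - p + e).
  move=> a Aa; rewrite (coordD cfP) van// add0r (coord_basis cfP)//.
  by have [ea|] := eqVneq e a => //; move: Aa; rewrite -ea.
have [|i wi] := star_set_vanish van; first by apply: h; exists (- p) => //; left.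
have [|j wj] := star_set_vanish vane.
  by apply: h; exists (- p + e); [right; exists (- p)|rewrite addrA].
move: wi wj; rewrite (lin_spanE cfP (PB (i := i))) (lin_spanE cfP (PB (i := j))) /=.
(* If [w - p] has a nonzero [e]-coordinate, then [e] is in [P i]; otherwise [w - p + e] has
   [e]-coordinate 1, and [e] is in [P j]. *)
have [wpe _|/[swap]/(_ e)/[swap] wpe wi] := eqVneq (cf (w - p) e) 0; last first.
  by move=> _; case: (nPe (wi wpe)).
move=> /(_ e); rewrite (coordD cfP) wpe add0r (coord_basis cfP)// eqxx oner_eq0.
by move=> /(_ isT)/nPe.
Qed.

(* If [x] and [y] lie in distinct spans [P i] and [P j], then [x + y] lies in
   none of them. *)
Lemma subspace_vanish V : vsubspace V -> V `<=` star_set ->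
  exists i, forall v, V v -> vanish v -> lin_span (P i) v.
Proof.
move=> hV VM.
have [[x [Vx vx x0]]|none] := pselect (exists x, [/\ V x, vanish x & x <> 0]); last first.
  exists i0 => v Vv vv; have [->|/eqP v0] := eqVneq v 0; last by case: none; exists v.
  by have /vsubspaceP[] := lin_span_vsubspace cfP (PB (i := i0)).
have [i xi] := star_set_vanish vx (VM _ Vx); exists i => y Vy vy.
have [j yj] := star_set_vanish vy (VM _ Vy).
have [|k xyk] := star_set_vanish _ (VM _ (vsubspaceD hV Vx Vy)).
  by move=> a Aa; rewrite (coordD cfP) vx// vy// addr0.
have [y0|/eqP y0] := eqVneq y 0.
  by rewrite y0; have /vsubspaceP[] := lin_span_vsubspace cfP (PB (i := i)).
have coordN0 u : u <> 0 -> exists z, cf u z != 0.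
  move=> u0; apply: contrapT => nz; apply: u0; apply: (coord_inj cfP) => z.
  by rewrite (coord0 cfP); apply/eqP; apply: contraT => uz; case: nz; exists z.
have [a xa] := coordN0 x x0; have [b yb] := coordN0 y y0.
suff <- : j = i by [].
move: xi yj xyk; rewrite (lin_spanE cfP (PB (i := i))).
rewrite (lin_spanE cfP (PB (i := j))) (lin_spanE cfP (PB (i := k))) /= => xi yj xyk.
apply: contrapT => ji.
have ya : cf y a = 0.
  by apply/eqP; apply: contraT => /yj Pja; case: ji; exact: Pdisj Pja (xi _ xa).
have xb : cf x b = 0.
  by apply/eqP; apply: contraT => /xi Pib; case: ji; exact: Pdisj (yj _ yb) Pib.
(* The sum [x + y] has nonzero coordinates at [a] in [P i] and at [b] in [P j], so [i] and [j] both
   equal [k]. *)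
apply: ji; rewrite (Pdisj (xi _ xa) (xyk a _)) ?(Pdisj (yj _ yb) (xyk b _))//.
  by rewrite (coordD cfP) xb add0r.
by rewrite (coordD cfP) ya addr0.
Qed.

Lemma lin_span_star_set i : lin_span (A `|` P i) `<=` star_set.
Proof.
move=> w; rewrite (lin_spanE cfP (APB (i := i))) => wAP.
have [[a [Aa wa]]|na] := pselect (exists a, A a /\ cf w a != 0).
  by left; exists a.
right; exists i; rewrite (lin_spanE cfP (PB (i := i))) => x wx.
by have [Ax|//] := wAP _ wx; case: na; exists x.
Qed.

(** Let [w] lie in a larger subspace inside the star set, and let [p] be its projection. Adding some
    [x] in [P i] to [w - p] gives a vector without coordinates on [A], hence in some span of [P j];
    its coordinate 1 at [x] forces [j = i]. So [w - p] is supported in [P i], where its coordinates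
    are 0. *)
Lemma maximal_lin_span i : maximal_subspace_in star_set (lin_span (A `|` P i)).
Proof.
have hAP := lin_span_vsubspace cfP (APB (i := i)).
split; [exact: hAP|exact: lin_span_star_set|move=> V hV VM sV].
apply/seteqP; split=> // w Vw.
have [p [APp pE]] := coord_projection cfP w (APB (i := i)).
have Vwp : V (w - p) by apply: vsubspaceB => //; exact: sV.
have wp0 x : (A `|` P i) x -> cf (w - p) x = 0.
  by move=> APx; rewrite (coordB cfP) pE mem_set// subrr.
suff : w - p = 0 by move/eqP; rewrite subr_eq0 => /eqP->.
have [x Px] := Pnonempty i.
have Vx : V x by apply/sV/sub_lin_span; right.
have wpx y : cf (w - p + x) y = cf (w - p) y + (x == y)%:R.
  by rewrite (coordD cfP) (coord_basis cfP _ (PB Px)).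
have [|j] := star_set_vanish _ (VM _ (vsubspaceD hV Vwp Vx)).
  move=> a Aa; rewrite wpx wp0; last by left.
  by case: eqP => [xa|]; [case: (PA Px); rewrite xa|rewrite addr0].
rewrite (lin_spanE cfP (PB (i := j))) => hj.
have ji : j = i.
  apply: (Pdisj _ Px); apply: hj; rewrite wpx eqxx wp0; last by right.
  by rewrite add0r oner_eq0.
apply: (coord_inj cfP) => y; rewrite (coord0 cfP).
have [<-|xy] := eqVneq x y; first by apply: wp0; right.
apply/eqP; apply: contraT => wpy.
by rewrite -(negbTE wpy) wp0 ?eqxx//; right; rewrite -ji; apply: hj; rewrite wpx (negbTE xy) addr0.
Qed.

(** Adding to [V] the span of the [P i] that holds its vectors without coordinates on [A] gives a
    subspace still inside the star set; by maximality it equals [V]. *)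
Lemma maximal_contains V : maximal_subspace_in star_set V ->
  exists i, lin_span (P i) `<=` V.
Proof.
move=> [hV VM Vmax]; have [i iP] := subspace_vanish hV VM; exists i.
have hPi := lin_span_vsubspace cfP (PB (i := i)).
have [V0 _] := (vsubspaceP.1 hV); have [P0 _] := (vsubspaceP.1 hPi).
pose V' := [set v + p | v in V & p in lin_span (P i)].
suff V'V : V' = V by move=> p Pp; rewrite -V'V; exists 0 => //; exists p; rewrite ?add0r.
apply: Vmax => [||v Vv]; last by exists v => //; exists 0; rewrite ?addr0.
  apply/vsubspaceP; split; first by exists 0 => //; exists 0; rewrite ?addr0.
  move=> c _ _ [v Vv [p Pp <-]] [v' Vv' [p' Pp' <-]].
  exists (c *: v + v'); first by apply: vsubspaceD => //; exact: vsubspaceZ.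
  exists (c *: p + p'); first by apply: vsubspaceD => //; exact: vsubspaceZ.
  by rewrite scalerDr addrACA.
move=> _ [v Vv [p Pp <-]].
have [[a [Aa va]]|na] := pselect (exists a, A a /\ cf (v + p) a != 0).
  by left; exists a.
right; exists i; apply: vsubspaceD => //; apply: iP => // a Aa.
apply/eqP; apply: contraT => va; case: na; exists a; split=> //.
by rewrite (coordD cfP) (lin_span_vanish Pp Aa) addr0.
Qed.

(* The coordinate projection onto the span of [A `|` P i] is injective on
   [V]. *)
Lemma subspace_card_le V : vsubspace V -> V `<=` star_set ->
  exists i, V #<= lin_span (A `|` P i).
Proof.
move=> hV VM; have [i iP] := subspace_vanish hV VM; exists i.
have /choice[pr prP] : forall w, exists p, lin_span (A `|` P i) p /\
    forall x, cf p x = if x \in A `|` P i then cf w x else 0.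
  by move=> w; exact: (coord_projection cfP w (APB (i := i))).
have prI : {in V &, injective pr}.
  move=> u v /set_mem Vu /set_mem Vv uv.
  have uv0 x : (A `|` P i) x -> cf (u - v) x = 0.
    move=> APx; have [_ /(_ x)] := prP u; have [_ /(_ x)] := prP v.
    by rewrite uv mem_set// (coordB cfP) => -> ->; rewrite subrr.
  have : lin_span (P i) (u - v).
    by apply: iP => [|a Aa]; [exact: vsubspaceB|apply: uv0; left].
  rewrite (lin_spanE cfP (PB (i := i))) => h.
  apply/eqP; rewrite -subr_eq0; apply/eqP/(coord_inj cfP) => x.
  rewrite (coord0 cfP); apply/eqP; apply: contraT => hx.
  by rewrite -(negbTE hx) uv0//; right; exact: h.
have /card_eqPle[_ le] := inj_card_eq prI.
apply: card_le_trans le (subset_card_le _) => _ [u _ <-].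
by have [] := prP u.
Qed.

End Construction.

(** * Realization of [alpha], [mu] and [lambda] *)

Unset Implicit Arguments.

Theorem theorem2p2 (K : fieldType) (W : lmodType K)
    (dimW succ_dimW alpha mu lambda : cardinal)
    (K_infinite : infinite_set [set: K])
    (dimWP : is_dim [set: W] dimW)
    (dimW_infinite : infinite_set [set: dimW])
    (succ_dimWP : is_card_succ dimW succ_dimW)
    (lt_K_alpha : [set: K] #< [set: alpha])
    (le_alpha_mu : [set: alpha] #<= [set: mu])
    (lt_mu_lambda : [set: mu] #< [set: lambda])
    (le_lambda_succ : [set: lambda] #<= [set: succ_dimW]) :
  exists M : set W,
    M `<` [set: W] /\ M 0 /\ star_like M /\
    is_additivity M alpha /\ is_max_lineability M mu /\ is_lineability M lambda.
Proof.
have [B basisB BD] := dimWP; have [iB _] := basisB.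
have [cf cfP] := basis_coordinates basisB.
have /infinite_injects infK := K_infinite; have /infinite_injects infD := dimW_infinite.
have [/card_leTP Ka _] := lt_K_alpha.
have infa := injects_trans infK Ka.
have /card_leTP am := le_alpha_mu.
have infm := injects_trans infa am.
have [/card_leTP ml nlm] := lt_mu_lambda.
have {}nlm : ~ injects lambda mu by move=> h; apply/nlm/card_leTP.
(* Otherwise [T] exceeds [dimW], so it is at least the successor of [dimW], hence at least
   [lambda]. *)
have leD (T : cardinal) : ~ injects lambda T -> injects T dimW.
  move=> nlT; have [//|DT] := injects_total T dimW.
  apply: contrapT => nTD; apply: nlT; apply/card_leTP.
  apply: card_le_trans le_lambda_succ _; apply: succ_dimWP.2.
  by split=> [|/card_leTP//]; exact/card_leTP.
have mD := leD _ nlm; have aD := injects_trans am mD.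
have DB : injects dimW B by apply/card_lesTP; have /card_eqPle[] := BD.
have [seg segP] := segments_realize_cardinals dimW.
(* One injection of [Z] into [B] yields all the pieces, disjoint by construction: [alpha] for [A],
   [unit] for [e], and for each index a copy of [mu + dimW] containing [P j]. *)
pose Z := (alpha + (unit + option dimW * (mu + dimW)))%type.
have [phi phiI] : injects Z B.
  apply: injects_trans DB; apply: injects_sum => //; apply: injects_sum => //.
    by have [f _] := infD; exists (fun=> f 0%N) => -[] [].
  apply: injects_prod => //; first by apply: injects_option => //; exact: injectsxx.
  by apply: injects_sum => //; exact: injectsxx.
pose b z := val (phi z).
have bI : injective b by move=> y z /val_inj/phiI.
have bB z : B (b z) by exact: set_mem (valP (phi z)).
pose Q (o : option dimW) : set (mu + dimW) :=
  [set y | if y is inr d then seg o d else True].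
pose A := range (fun a : alpha => b (inl a)).
pose e := b (inr (inl tt)).
(* Only segments of cardinality below [lambda] are kept. As [mu] is below [lambda] too, each [P j]
   has fewer than [lambda] elements. *)
pose J := {o : option dimW | ~ injects lambda (seg o)}.
pose P (j : J) := [set b (inr (inr (sval j, y))) | y in Q (sval j)].
have realize (T : cardinal) : ~ injects lambda T ->
    exists j : J, [set: T] #= seg (sval j).
  move=> nlT; have [o To] := segP _ (leD _ nlT).
  suff no : ~ injects lambda (seg o) by exists (exist _ o no).
  move=> lo; apply: nlT; apply: injects_trans lo _; apply/card_leTsP.
  by have /card_eqPle[] := To.
(* This [P jm] has [mu + mu], that is [mu], elements, and will attain the maximal lineability
   number. *)
have [jm jmP] := realize _ nlm.
have AB : A `<=` B by move=> _ [a _ <-].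
have PB j : P j `<=` B by move=> _ [y _ <-].
have nAe : ~ A e by move=> [a _ /bI].
have PA j x : P j x -> ~ A x by move=> [y _ <-] [a _ /bI].
have nPe j : ~ P j e by move=> [y _ /bI].
have Pdisj i j x : P i x -> P j x -> i = j.
  by move: i j => [i ni] [j nj] [y _ <-] [z _ /bI[/= ji _]]; apply/eq_exist.
have muP j : injects mu (P j).
  apply/card_lesTP; pose f m := b (inr (inr (sval j, inl m))).
  have /card_eqPle[_ le] : f @` setT #= [set: mu].
    by apply: inj_card_eq => x y _ _ /bI[].
  apply: card_le_trans le (subset_card_le _) => _ [m _ <-].
  by exists (inl m).
have infP j : infinite_set (P j) by apply/infiniteP/card_lesTP; exact: injects_trans (muP j).
have Pnonempty j : P j !=set0 by exact: infinite_setN0.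
have alphaA : injects alpha A.
  apply/card_lesTP; have /card_eqPle[_ le] : A #= [set: alpha]; last exact: le.
  by apply: inj_card_eq => x y _ _ /bI[].
have Aalpha : injects A alpha by apply/card_leTsP; exact: card_image_le.
have PX j (X : Type) : injects nat X -> injects mu X -> injects (seg (sval j)) X ->
    injects (P j) X.
  move=> infX mX sX; apply: injects_trans (injects_sum infX mX sX).
  apply: injects_trans (card_lesP.1 (card_image_le _ _)) _.
  have /choice[f fP] : forall y : (Q (sval j) : set _), exists s : mu + seg (sval j),
      val y = match s with inl m => inl m | inr d => inr (val d) end.
    move=> [[m|d] /= /set_mem Qy]; first by exists (inl m).
    by have sd : seg (sval j) d := Qy; exists (inr (SigSub (mem_set sd))).
  by exists f => x y fxy; apply: val_inj; rewrite !fP fxy.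
(* The larger of [mu] and [seg (sval j)] serves as [X]. It also bounds [K], hence the whole span of
   the union of [A] and [P j]. *)
have boundAP j : exists X : Type, [/\ injects nat X, injects K X,
    injects (A `|` P j : set W) X & ~ injects lambda X].
  have bound X : injects mu X -> injects (seg (sval j)) X -> ~ injects lambda X ->
      [/\ injects nat X, injects K X, injects (A `|` P j : set W) X & ~ injects lambda X].
    move=> mX sX nlX; have infX := injects_trans infm mX.
    have aX := injects_trans am mX; split=> //; first exact: injects_trans Ka aX.
    apply: injects_setU => //; first exact: injects_trans Aalpha aX.
    exact: PX.
  have [ms|sm] := injects_total mu (seg (sval j)).
    by exists (seg (sval j)); apply: bound => //; [exact: injectsxx|exact: svalP j].
  by exists mu; apply: bound => //; exact: injectsxx.
pose M := @star_set K W cf J A P.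
have M0 : M 0 by exact: (star_set0 cfP jm PB).
have MU : M `|` [set 0] = M by exact: (star_setU0 cfP jm PB).
exists M; split; first exact: (star_set_proper cfP (bB _) nAe PB nPe).
split=> //; split; first exact: (star_set_star_like cfP PB).
split; [|split].
- split.
    left; exists (@untranslatable K W A e); split; last first.
      exact: (star_set_untranslatable cfP AB (bB _) nAe PB nPe).
    have sA : injects (lin_span A) alpha.
      exact: injects_lin_span infa Ka Aalpha.
    apply/card_eqPle; split.
      apply/card_leTsP; apply: injects_setU => //.
      exact: injects_trans (card_lesP.1 (card_image_le _ _)) sA.
    apply: card_le_trans (card_lesTP.2 alphaA) (subset_card_le _) => x Ax.
    by left; exact: sub_lin_span.
  (* If [k] is the successor of the cardinality of [W], then [alpha] is at most [dimW], hence at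
     most the cardinality of [W] and at most [k]. *)
  move=> k [[F [Fk nF]]|[[Wk _] _]]; last first.
    apply: card_le_trans Wk; apply/card_leTP; apply: injects_trans aD _.
    exact: injects_trans DB (injects_set _).
  have AF : A `<=` \bigcup_(f in F) [set x | cf f x != 0].
    apply: contrapT => /(star_set_translate (P := P) cfP AB)[w wF].
    exact: nF wF.
  have infA : infinite_set A by apply/infiniteP/card_lesTP; exact: injects_trans alphaA.
  (* The supports of [F] are finite and cover the infinite set [A], so [F] is infinite and at least
     as large as [A]. *)
  have infF : infinite_set F.
    move=> finF; apply: infA; apply: sub_finite_set AF _.
    by apply: bigcup_finite => // f _; exact: (coord_finite cfP f).
  apply: card_le_trans (card_lesTP.2 alphaA) _.
  apply: card_le_trans (subset_card_le AF) _.
  have /card_eqPle[Fk' _] := Fk; apply: card_le_trans Fk'; apply/card_lesP.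
  apply: injects_bigcup_finite; first exact/card_lesTP/infiniteP.
    exact: injectsxx.
  by move=> f _; exact: (coord_finite cfP f).
- split.
    exists (lin_span (A `|` P jm)); rewrite MU; split.
      exact: (maximal_lin_span cfP AB PB PA Pdisj Pnonempty jm).
    apply: (lin_span_is_dim iB); first by move=> x [/AB|/PB].
    apply/card_eqPle; split.
      apply/card_leTsP; apply: injects_setU => //; first exact: injects_trans Aalpha am.
      apply: PX => //; first exact: injectsxx.
      by apply/card_leTsP; have /card_eqPle[] := jmP.
    apply: card_le_trans (card_lesTP.2 (muP jm)) (subset_card_le _).
    by move=> x Px; right.
  move=> k [V []]; rewrite MU => maxV [B' [iB' spanB'] /card_eqPle[B'k _]].
  (* A basis of [V] generates [P j], which has at least [mu] elements. *)
  have [j jV] := maximal_contains cfP jm PB PA Pdisj maxV.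
  apply: card_le_trans B'k; apply: card_le_trans (card_lesTP.2 (muP j)) _.
  apply: (card_le_generating cfP (infP j) (PB j)).
  by rewrite spanB'; apply: subset_trans jV; exact: sub_lin_span.
- split.
    move=> [V [hV]]; rewrite MU => VM [B' [iB' spanB'] /card_eqPle[_ lB']].
    have [j Vj] := subspace_card_le cfP jm AB PB Pdisj hV VM.
    have [X [infX KX APX]] := boundAP j; apply.
    (* Cardinalities replace dimensions: a basis of [V] with [lambda] elements would inject into [X]
       through the span of the union of [A] and [P j]. *)
    apply: injects_trans (card_lesTP.1 lB') _.
    apply: injects_trans (injects_lin_span infX KX APX); apply/card_lesP.
    apply: card_le_trans Vj; apply: subset_card_le; rewrite -spanB'.
    exact: sub_lin_span.
  move=> k nk; apply: contrapT => nlk; apply: nk.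
  have {}nlk : ~ injects lambda k by move=> h; apply/nlk/card_leTP.
  (* A [k] not reaching [lambda] is the size of the segment part of some [P j], whose span is a
     subspace of dimension [k] in [M]. *)
  have [j kj] := realize _ nlk.
  pose S := [set b (inr (inr (sval j, inr d))) | d in seg (sval j)].
  have SP : S `<=` P j by move=> _ [d sd <-]; exists (inr d).
  have SB : S `<=` B by exact: subset_trans SP (PB j).
  exists (lin_span S); split; first exact: (lin_span_vsubspace cfP SB).
    rewrite MU; apply: subset_trans (lin_span_star_set cfP AB PB (i := j)).
    move=> w [s [c [sS ->]]]; exists s, c; split=> // x /sS Sx.
    by right; exact: SP.
  apply: (lin_span_is_dim iB SB); apply: card_eq_trans (card_esym kj).
  by apply: inj_card_eq => x y _ _ /bI[].
Qed.
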